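(* Let $S=F[[x,y]]/(x^2y)$. Each module $M_k$, $k\ge1$, is isolated in $\mathrm{ZCM}_S$ by a minimal pair, and the same holds true for $B=yS$.
   Context: $F$ is an algebraically closed field of characteristic different from $2$. An arbitrary $S$-module $M$ is Cohen--Macaulay (CM) if $\operatorname{Soc}(M)=0$, i.e. for $m\in M$, $mx=my=0$ implies $m=0$. $M_k$ ($k\ge1$) is the $S$-module with generators $m,n$ and relations $mx=ny^k$, $nx=0$; $B$ is the ideal $yS$ of $S$ regarded as an $S$-module. All finitely generated CM $S$-modules are pure injective. A pp-formula (in one free variable $v$) is a formula $\exists\,\overline w\,(\overline w A=v\,\overline b)$ in the language of $S$-modules, with $A$ a matrix and $\overline b$ a column over $S$; $\varphi(M)$ denotes the set of elements of $M$ satisfying $\varphi$. $L_{CM}$ is the lattice of pp-formulae modulo equivalence on all CM $S$-modules, ordered by implication on CM-modules. $\mathrm{ZCM}_S$ is the space whose points are isomorphism classes of indecomposable pure injective CM $S$-modules, with basic open sets $(\varphi/\psi)=\{M:\varphi(M)\not\subseteq\psi(M)\}$. A minimal pair is a pair $\psi<\varphi$ in $L_{CM}$ with no element of $L_{CM}$ strictly between. A point $P$ is isolated by a minimal pair $\varphi/\psi$ if $P$ is the only point of $(\varphi/\psi)$. *)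

(* Defs.v *)
From HB Require Import structures.
From mathcomp Require Import all_boot all_order all_algebra.
From mathcomp Require Import generic_quotient ring_quotient.
From mathcomp Require Import boolp.

Set Implicit Arguments.
Unset Strict Implicit.
Unset Printing Implicit Defensive.

Import GRing.Theory.
Local Open Scope ring_scope.
Local Open Scope quotient_scope.

Record fps (R : Type) := Fps { fcoef : nat -> R }.

HB.instance Definition _ (R : Type) := [isNew for @fcoef R].
HB.instance Definition _ (R : choiceType) := [Choice of fps R by <:].

Section FpsRing.
Variable R : comNzRingType.
Implicit Types f g h : fps R.

Lemma fpsP f g : (forall n, fcoef f n = fcoef g n) -> f = g.
Proof. by case: f g => [f] [g] /= fg; congr Fps; apply/funext. Qed.

Definition fps_zero : fps R := Fps (fun=> 0).
Definition fps_opp f : fps R := Fps (fun n => - fcoef f n).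
Definition fps_add f g : fps R := Fps (fun n => fcoef f n + fcoef g n).
Definition fps_one : fps R := Fps (fun n => (n == 0%N)%:R).
Definition fps_mul f g : fps R :=
  Fps (fun n => \sum_(i < n.+1) fcoef f i * fcoef g (n - i)%N).

Lemma fps_addA : associative fps_add.
Proof. by move=> f g h; apply: fpsP => n /=; rewrite addrA. Qed.
Lemma fps_addC : commutative fps_add.
Proof. by move=> f g; apply: fpsP => n /=; rewrite addrC. Qed.
Lemma fps_add0 : left_id fps_zero fps_add.
Proof. by move=> f; apply: fpsP => n /=; rewrite add0r. Qed.
Lemma fps_addN : left_inverse fps_zero fps_opp fps_add.
Proof. by move=> f; apply: fpsP => n /=; rewrite addNr. Qed.

HB.instance Definition _ :=
  GRing.isZmodule.Build (fps R) fps_addA fps_addC fps_add0 fps_addN.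

Definition fps_trunc N f : {poly R} := \poly_(i < N) fcoef f i.

Lemma fcoef_mul_poly f g (p q : {poly R}) n :
    (forall i, (i <= n)%N -> fcoef f i = p`_i) ->
    (forall i, (i <= n)%N -> fcoef g i = q`_i) ->
  forall i, (i <= n)%N -> fcoef (fps_mul f g) i = (p * q)`_i.
Proof.
move=> fp gq i le_in; rewrite coefM /=; apply: eq_bigr => -[j /= lt_ji] _.
by rewrite fp ?gq ?(leq_trans (leq_subr _ _)) // (leq_trans _ le_in).
Qed.

Lemma fcoef_trunc n f i : (i <= n)%N -> fcoef f i = (fps_trunc n.+1 f)`_i.
Proof. by move=> le_in; rewrite coef_poly ltnS le_in. Qed.

Lemma fps_mulA : associative fps_mul.
Proof.
move=> f g h; apply: fpsP => n.
have ft := @fcoef_trunc n.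
rewrite (fcoef_mul_poly (ft f) (fcoef_mul_poly (ft g) (ft h))) //.
by rewrite (fcoef_mul_poly (fcoef_mul_poly (ft f) (ft g)) (ft h)) // mulrA.
Qed.

Lemma fps_mulC : commutative fps_mul.
Proof.
move=> f g; apply: fpsP => n; have ft := @fcoef_trunc n.
by rewrite (fcoef_mul_poly (ft f) (ft g)) // (fcoef_mul_poly (ft g) (ft f)) // mulrC.
Qed.

Lemma fps_mul1 : left_id fps_one fps_mul.
Proof.
move=> f; apply: fpsP => n; have ft := @fcoef_trunc n.
rewrite (@fcoef_mul_poly _ _ 1 _ _ _ (ft f)) // ?mul1r -?ft //.
by move=> i _; rewrite coef1.
Qed.

Lemma fps_mulDl : left_distributive fps_mul fps_add.
Proof.
move=> f g h; apply: fpsP => n /=; rewrite -big_split /=.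
by apply: eq_bigr => i _; rewrite mulrDl.
Qed.

Lemma fps_one_neq0 : fps_one != 0.
Proof.
apply/eqP => /(congr1 (fun f => fcoef f 0)) /= /eqP.
by rewrite oner_eq0.
Qed.

HB.instance Definition _ := GRing.Zmodule_isComNzRing.Build (fps R)
  fps_mulA fps_mulC fps_mul1 fps_mulDl fps_one_neq0.

Definition fpsC (a : R) : fps R := Fps (fun n => if n == 0%N then a else 0).
Definition fpsX : fps R := Fps (fun n => (n == 1%N)%:R).

Lemma fcoef0M f g : fcoef (f * g) 0 = fcoef f 0 * fcoef g 0.
Proof. by rewrite /= big_ord1. Qed.

End FpsRing.

Section Ring.
Variable F : fieldType.

(** F[[x,y]] is realised as F[[x]][[y]]: the coefficient of x^i y^j in [f] is
    [fcoef (fcoef f j) i]. *)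
Definition fps2 : comNzRingType := fps (fps F).
Definition X2 : fps2 := fpsC (fpsX F).
Definition Y2 : fps2 := fpsX (fps F).

Definition Dinf_ideal : {pred fps2} :=
  fun f => `[< exists g : fps2, f = X2 ^+ 2 * Y2 * g >].

Lemma Dinf_ideal_closed : idealr_closed Dinf_ideal.
Proof.
split.
- by apply/asboolP; exists 0; rewrite mulr0.
- apply/negP => /asboolP[g] /(congr1 (fun f => fcoef f 0)) /eqP.
  by rewrite !fcoef0M /= mulr0 mul0r oner_eq0.
- move=> a _ _ /asboolP[g ->] /asboolP[h ->]; apply/asboolP.
  by exists (a * g + h); rewrite mulrDr mulrCA.
Qed.

HB.instance Definition _ := isIdealr.Build fps2 Dinf_ideal Dinf_ideal_closed.

Definition Sring : comNzRingType := {ideal_quot Dinf_ideal}.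
Definition xS : Sring := \pi_{ideal_quot Dinf_ideal} X2.
Definition yS : Sring := \pi_{ideal_quot Dinf_ideal} Y2.

Lemma Dinf_relation : xS ^+ 2 * yS = 0.
Proof.
rewrite /xS /yS -rmorphXn -rmorphM /=; apply/eqP.
rewrite -(rmorph0 (\pi_{ideal_quot Dinf_ideal})) -Quotient.idealrBE subr0.
by apply/asboolP; exists 1; rewrite mulr1.
Qed.

End Ring.

(** [coker A] is the module with one generator for each column of [A] and one
    relation for each row of [A]. *)

Section Coker.
Variables (R : comNzRingType) (r g : nat) (A : 'M[R]_(r, g)).

Definition rowspan : {pred 'rV[R]_g} :=
  fun u => `[< exists c : 'rV[R]_r, u = c *m A >].

Lemma rowspan_closed : submod_closed rowspan.
Proof.
split; first by apply/asboolP; exists 0; rewrite mul0mx.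
move=> a _ _ /asboolP[c ->] /asboolP[d ->]; apply/asboolP.
by exists (a *: c + d); rewrite mulmxDl scalemxAl.
Qed.

HB.instance Definition _ :=
  GRing.isSubmodClosed.Build R 'rV[R]_g rowspan
    (GRing.submod_closed_semi rowspan_closed).
Definition coker : Type := Quotient.quot rowspan.
HB.instance Definition _ := GRing.Zmodule.on coker.

Definition coker_pi (u : 'rV[R]_g) : coker := \pi_(Quotient.quot rowspan) u.
Definition coker_scale (a : R) (q : coker) : coker :=
  coker_pi (a *: repr (q : Quotient.quot rowspan)).

Lemma coker_piP (u v : 'rV[R]_g) :
  coker_pi u = coker_pi v <-> exists c : 'rV[R]_r, u - v = c *m A.
Proof.
split=> [/eqP | uv].
  by rewrite -Quotient.idealrBE => /asboolP.
by apply/eqP; rewrite -Quotient.idealrBE; apply/asboolP.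
Qed.

Lemma coker_reprK (q : coker) :
  coker_pi (repr (q : Quotient.quot rowspan)) = q.
Proof. exact: reprK. Qed.

Lemma coker_piD : {morph coker_pi : u v / u + v}.
Proof. by move=> u v; rewrite /coker_pi raddfD. Qed.

Lemma coker_piZ a u : coker_pi (a *: u) = coker_scale a (coker_pi u).
Proof.
have /coker_piP[c def_c] := coker_reprK (coker_pi u).
apply/coker_piP; exists (- a *: c).
by rewrite -scalerBr -opprB def_c -scalemxAl scaleNr scalerN.
Qed.

Lemma coker_scaleA a b q :
  coker_scale a (coker_scale b q) = coker_scale (a * b) q.
Proof. by rewrite -(coker_reprK q) -!coker_piZ scalerA. Qed.
Lemma coker_scale1 : left_id 1 coker_scale.
Proof. by move=> q; rewrite -(coker_reprK q) -coker_piZ scale1r. Qed.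
Lemma coker_scaleDr : right_distributive coker_scale +%R.
Proof.
move=> a p q; rewrite -(coker_reprK p) -(coker_reprK q).
by rewrite -coker_piD -!coker_piZ scalerDr coker_piD.
Qed.
Lemma coker_scaleDl q : {morph coker_scale^~ q : a b / a + b}.
Proof.
move=> a b /=; rewrite -(coker_reprK q).
by rewrite -!coker_piZ scalerDl coker_piD.
Qed.

HB.instance Definition _ := GRing.Zmodule_isLmodule.Build R coker
  coker_scaleA coker_scale1 coker_scaleDr coker_scaleDl.

End Coker.

Section PrincipalIdeal.
Variables (R : comNzRingType) (s : R).

Definition principal : {pred R^o} := fun r => `[< exists t : R, r = s * t >].

Lemma principal_closed : submod_closed principal.
Proof.
split; first by apply/asboolP; exists 0; rewrite mulr0.
move=> a _ _ /asboolP[t ->] /asboolP[u ->]; apply/asboolP.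
by exists (a * t + u); rewrite mulrDr mulrCA.
Qed.

HB.instance Definition _ :=
  GRing.isSubmodClosed.Build R R^o principal
    (GRing.submod_closed_semi principal_closed).

Record principal_mod := PrincipalMod {
  principal_val : R^o;
  principal_valP : principal_val \in principal }.

HB.instance Definition _ := [isSub for principal_val].
HB.instance Definition _ := [Choice of principal_mod by <:].
HB.instance Definition _ := [SubChoice_isSubLmodule of principal_mod by <:].

End PrincipalIdeal.

Section Modules.
Variable R : comNzRingType.
Implicit Types M N : lmodType R.

Definition module_iso M N : Prop := exists f : {linear M -> N}, bijective f.

Definition indecomposable M : Prop :=
  (exists m : M, m != 0) /\
  (forall N1 N2 : lmodType R, module_iso M (N1 * N2)%type ->
    (forall u : N1, u = 0) \/ (forall u : N2, u = 0)).

(** Every finite system of linear equations with constants in [M] that is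
    solvable in [N] is solvable in [M]; the system without unknowns shows that
    [f] is then injective. *)
Definition pure_mono M N (f : {linear M -> N}) : Prop :=
  forall (p q : nat) (A : 'M[R]_(p, q)) (c : 'I_q -> M),
    (exists w : 'I_p -> N, forall j, \sum_i A i j *: w i = f (c j)) ->
    (exists w : 'I_p -> M, forall j, \sum_i A i j *: w i = c j).

Definition pure_injective M : Prop :=
  forall (N1 N2 : lmodType R) (f : {linear N1 -> N2}) (g : {linear N1 -> M}),
    pure_mono f -> exists h : {linear N2 -> M}, forall u, h (f u) = g u.

(** The formula  exists w, w A = v b. *)
Record pp := Pp {
  pp_vars : nat;
  pp_eqs : nat;
  pp_mx : 'M[R]_(pp_vars, pp_eqs);
  pp_rhs : 'rV[R]_pp_eqs }.

Definition pp_sat (phi : pp) M (v : M) : Prop :=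
  exists w : 'I_(pp_vars phi) -> M,
    forall j, \sum_i pp_mx phi i j *: w i = pp_rhs phi 0 j *: v.

End Modules.

Section CM.
Variable F : fieldType.
Local Notation S := (Sring F).
Implicit Types (M P Q : lmodType S) (phi psi theta : pp S).

Definition is_CM M : Prop :=
  forall m : M, xS F *: m = 0 -> yS F *: m = 0 -> m = 0.

(** L_CM is the partial order induced by the preorder [le_CM]; its elements are
    handled through representing formulae, and [lt_CM] is the strict order
    between the classes of its arguments. *)
Definition le_CM psi phi : Prop :=
  forall M, is_CM M -> forall v : M, pp_sat psi v -> pp_sat phi v.

Definition lt_CM psi phi : Prop := le_CM psi phi /\ ~ le_CM phi psi.

Definition minimal_pair phi psi : Prop :=
  lt_CM psi phi /\ ~ (exists theta, lt_CM psi theta /\ lt_CM theta phi).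

(** [M] represents a point of ZCM_S; points are equal when the modules are
    isomorphic. *)
Definition ZCM_point M : Prop :=
  [/\ indecomposable M, pure_injective M & is_CM M].

Definition basic_open phi psi M : Prop :=
  ~ (forall v : M, pp_sat phi v -> pp_sat psi v).

Definition isolated_by phi psi P : Prop :=
  [/\ ZCM_point P, basic_open phi psi P &
      forall Q, ZCM_point Q -> basic_open phi psi Q -> module_iso Q P].

Definition isolated_by_minimal_pair P : Prop :=
  exists phi psi, minimal_pair phi psi /\ isolated_by phi psi P.

(** Columns are the generators m, n; rows are the relations
    x m - y^k n = 0 and x n = 0. *)
Definition Mk_rel (k : nat) : 'M[S]_2 :=
  \matrix_(i, j)
    if i == 0 then (if j == 0 then xS F else - yS F ^+ k)
    else (if j == 0 then 0 else xS F).

Definition Mk (k : nat) : lmodType S := coker (Mk_rel k).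

Definition Bmod : lmodType S := principal_mod (yS F).

Definition Mk_m k : Mk k := coker_pi (Mk_rel k) (delta_mx 0 0).
Definition Mk_n k : Mk k := coker_pi (Mk_rel k) (delta_mx 0 1).

Lemma Mk_relation1 k : xS F *: Mk_m k = yS F ^+ k *: Mk_n k.
Proof.
rewrite -[LHS]coker_piZ -[RHS]coker_piZ; apply/coker_piP.
exists (delta_mx 0 0); rewrite -rowE; apply/rowP => j; rewrite !mxE /=.
by case: j => [] [|[|//]] ? /=; rewrite ?mulr1 ?mulr0 ?subr0 ?sub0r.
Qed.

Lemma Mk_relation2 k : xS F *: Mk_n k = 0.
Proof.
have ->: (0 : Mk k) = coker_pi (Mk_rel k) 0.
  by rewrite /coker_pi raddf0.
rewrite -[LHS]coker_piZ; apply/coker_piP.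
exists (delta_mx 0 1); rewrite -rowE; apply/rowP => j; rewrite !mxE /=.
by case: j => [] [|[|//]] ? /=; rewrite ?mulr1 ?mulr0 ?subr0.
Qed.

End CM.

(* Main.v *)
Require Import Defs.
From HB Require Import structures.
From mathcomp Require Import all_boot all_order all_algebra.
From mathcomp Require Import generic_quotient ring_quotient ring.
From mathcomp Require Import boolp classical_sets functions.

Set Implicit Arguments.
Unset Strict Implicit.
Unset Printing Implicit Defensive.

(** Write V = F[[y]].  For k >= 0 (with M_0 = B) the module M_k is V-free on
    m, n, with x m = y^k n and x n = 0.  In a CM module Q, let phi(q) say that
    x q = y^k r and x r = 0 for some r, that is, q is the image of m under a map
    M_k -> Q, and let psi(q) say in addition that x q lies in
    y^(k+1) Q + x y Q.  If q satisfies phi but not psi, then the map M_k -> Q is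
    a split monomorphism.  Hence psi < phi is a minimal pair, and a point that
    opens it has M_k as a direct summand.

    A map N -> M_k is a sequence of F-linear functionals b_j on N (the
    coefficients of y^j n) such that b_j (y u) = b_(j-1) u, b_j (x u) = 0 for
    j < k and b_j (x^2 u) = 0.  So extending such a map is a problem of extending
    a single F-linear functional, with the only obstruction given by
    [Mk_basis_extend].  This obstruction vanishes along pure monomorphisms, so
    M_k is pure injective; it also vanishes for M_k -> Q as above, because y is
    regular on the annihilator of x^2 in Q. *)

Import GRing.Theory.
Local Open Scope ring_scope.

(** * Extension of partial linear functionals *)

(** G is the graph of a partial functional: by linearity, being single-valued at 0 suffices. A
    maximal linear graph containing G has full domain. *)
Lemma linear_extension (F : fieldType) (R : nzRingType) (i : {rmorphism F -> R})
    (E : lmodType R) (G : E -> F -> Prop) :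
    (forall c u r v s, G u r -> G v s -> G (i c *: u + v) (c * r + s)) ->
    G 0 0 -> (forall r, G 0 r -> r = 0) ->
  exists H : E -> F, (forall c u v, H (i c *: u + v) = c * H u + H v) /\
    (forall u r, G u r -> H u = r).
Proof.
move=> Glin G00 Gfun.
pose GS : set (E * F) := [set ur | G ur.1 ur.2]%classic.
pose good (Y : set (E * F)) :=
  (forall c u r v s, Y (u, r) -> Y (v, s) -> Y (i c *: u + v, c * r + s)) /\
  (forall r, Y (0, r) -> r = 0).
(* Goodness is tested on the union with G, so the empty chain is harmless and the maximal graph
   contains G. *)
have [|A [[Ylin Yfun] Amax]] := @Zorn_bigcup _ (fun X => good (X `|` GS)%classic).
  move=> C CP Ctot; set U := (\bigcup_(X in C) X)%classic.
  have common a b : (U `|` GS)%classic a -> (U `|` GS)%classic b ->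
      exists X, [/\ good (X `|` GS), (X `|` GS) a, (X `|` GS) b & X `<=` U]%classic.
    have CU X : C X -> (X `<=` U)%classic by move=> CX z Xz; exists X.
    move=> [[X CX Xa]|Ga] [[Z CZ Zb]|Gb].
    - have [XZ|ZX] := Ctot _ _ CX CZ.
        by exists Z; split; [exact: CP|left; exact: XZ|left|exact: CU].
      by exists X; split; [exact: CP|left|left; exact: ZX|exact: CU].
    - by exists X; split; [exact: CP|left|right|exact: CU].
    - by exists Z; split; [exact: CP|right|left|exact: CU].
    exists set0; split=> [|||z []]; [|by right|by right].
    by rewrite set0U; split.
  split=> [c u r v s Yu Yv|r Yr].
    have [X [[Xlin _] Xu Xv XU]] := common _ _ Yu Yv.
    by case: (Xlin c _ _ _ _ Xu Xv) => [/XU|]; [left|right].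
  by have [X [[_ Xfun] Xu _ _]] := common _ _ Yr Yr; exact: Xfun.
set Y := (A `|` GS)%classic in Ylin Yfun.
have Y00 : Y (0, 0) by right.
have Ytot u0 : exists r, Y (u0, r).
  apply: contrapT => nY.
  (* Adjoin u0 to the domain, with value 0. *)
  pose B : set (E * F) := [set w | exists c u, Y (u, w.2) /\ w.1 = i c *: u0 + u]%classic.
  have YB : (Y `<=` B)%classic.
    by move=> [u r] Yu; exists 0, u; rewrite rmorph0 scale0r add0r.
  have BG : (B `|` GS)%classic = B.
    by apply/seteqP; split=> z; [case=> // Gz; apply: YB; right|left].
  apply: (Amax B); last first.
    rewrite BG; split=> [c u r v s [c1 [u1 /= [Y1 ->]]] [c2 [u2 /= [Y2 ->]]]|r].
      exists (c * c1 + c2), (i c *: u1 + u2); split; first exact: Ylin.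
      by rewrite rmorphD rmorphM scalerDl scalerDr -scalerA addrACA.
    move=> [c [u /= [Yu eq0]]]; have [c0|c0] := eqVneq c 0.
      by move: eq0; rewrite c0 rmorph0 scale0r add0r => u0E; apply: Yfun; rewrite u0E.
    (* As c is nonzero, u0 = - c^-1 u already lies in the domain. *)
    case: nY; exists (- c^-1 * r + 0).
    have -> : u0 = i (- c^-1) *: u + 0.
      have /eqP := eq0; rewrite eq_sym addr_eq0 => /eqP uE.
      rewrite addr0 rmorphN scaleNr -scalerN -uE scalerA -rmorphM mulVf //.
      by rewrite rmorph1 scale1r.
    exact: Ylin.
  rewrite properEneq; split; last by move=> z Az; apply: YB; left.
  apply/eqP => AB; apply: nY; exists 0; left; rewrite AB.
  by exists 1, 0; split=> //=; rewrite rmorph1 scale1r addr0.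
have [H HY] := choice Ytot.
have Yinj u r s : Y (u, r) -> Y (u, s) -> r = s.
  move=> Yr Ys; have := Ylin (-1) _ _ _ _ Yr Ys.
  rewrite rmorphN rmorph1 scaleN1r addNr mulN1r => /Yfun/eqP.
  by rewrite addrC subr_eq0 => /eqP.
exists H; split=> [c u v|u r Gu]; first by apply: Yinj (HY _) _; exact: Ylin.
by apply: Yinj (HY _) _; right.
Qed.

(** * Power series in one variable *)

Section PowerSeries.
Variable R : comNzRingType.
Implicit Types (a : R) (u v : fps R).

Lemma fcoefD u v i : fcoef (u + v) i = fcoef u i + fcoef v i.
Proof. by []. Qed.

Lemma fcoefCM a v i : fcoef (fpsC a * v) i = a * fcoef v i.
Proof.
rewrite [LHS]big_ord_recl /= subn0 big1 ?addr0 // => j _.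
by rewrite mul0r.
Qed.

Lemma fcoefXM v i : fcoef (fpsX R * v) i = if i is j.+1 then fcoef v j else 0.
Proof.
case: i => [|i]; first by rewrite fcoef0M mul0r.
rewrite [LHS]big_ord_recl /= mul0r add0r big_ord_recl /= mul1r subSS subn0.
by rewrite big1 ?addr0 // => j _; rewrite /= mul0r.
Qed.

Lemma fcoefXnM n v i :
  fcoef (fpsX R ^+ n * v) i = if (i < n)%N then 0 else fcoef v (i - n).
Proof.
elim: n i => [|n IHn] i; first by rewrite expr0 mul1r subn0.
by rewrite exprS -mulrA fcoefXM; case: i => [|i] //; rewrite IHn ltnS subSS.
Qed.

Lemma fpsX_inj : injective ( *%R (fpsX R)).
Proof.
move=> u v uv; apply: fpsP => i.
by have := congr1 (fun w => fcoef w i.+1) uv; rewrite !fcoefXM.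
Qed.

Lemma fpsXn_inj n : injective ( *%R (fpsX R ^+ n)).
Proof.
elim: n => [|n IHn] u v; first by rewrite expr0 !mul1r.
by rewrite exprS -!mulrA => /fpsX_inj/IHn.
Qed.

Lemma fpsC_is_additive : zmod_morphism (@fpsC R).
Proof. by move=> a b; apply: fpsP => -[|i] //=; rewrite subrr. Qed.
Lemma fpsC_is_multiplicative : monoid_morphism (@fpsC R).
Proof.
split=> [|a b]; apply: fpsP => i; last first.
  by rewrite fcoefCM /=; case: i => [|i] //=; rewrite mulr0.
by case: i.
Qed.
HB.instance Definition _ :=
  GRing.isZmodMorphism.Build R (fps R) (@fpsC R) fpsC_is_additive.
HB.instance Definition _ :=
  GRing.isMonoidMorphism.Build R (fps R) (@fpsC R) fpsC_is_multiplicative.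

Lemma fps_split v : v = fpsC (fcoef v 0) + fpsX R * Fps (fun i => fcoef v i.+1).
Proof.
apply: fpsP => i; rewrite fcoefD fcoefXM.
by case: i => [|i] /=; rewrite ?addr0 ?add0r.
Qed.

(** Dividing by the variable until the constant term is nonzero isolates the lowest term; the index
    i serves to bound its exponent. *)
Lemma fps_lowest v i : fcoef v i != 0 ->
  exists e c w, [/\ (e <= i)%N, c != 0 & v = fpsX R ^+ e * (fpsC c + fpsX R * w)].
Proof.
elim: i v => [|i IHi] v vi.
  by exists 0, (fcoef v 0), (Fps (fun i => fcoef v i.+1)); rewrite mul1r -fps_split.
have [v0|v0] := eqVneq (fcoef v 0) 0; last first.
  by exists 0, (fcoef v 0), (Fps (fun i => fcoef v i.+1)); rewrite mul1r -fps_split.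
have [e [c [w [le_ei c0 vE]]]] := IHi (Fps (fun i => fcoef v i.+1)) vi.
exists e.+1, c, w; split=> //.
by rewrite [LHS]fps_split v0 rmorph0 add0r vE exprS mulrA.
Qed.

Lemma fps_div_Xn v n : (forall i, (i < n)%N -> fcoef v i = 0) ->
  exists w, v = fpsX R ^+ n * w.
Proof.
move=> v0; exists (Fps (fun i => fcoef v (i + n))); apply: fpsP => i.
rewrite fcoefXnM; case: ltnP => [/v0//|le_ni] /=.
by rewrite subnK.
Qed.

End PowerSeries.

Lemma fps_mulf_eq0 (F : fieldType) (u v : fps F) : u * v = 0 -> u = 0 \/ v = 0.
Proof.
have [->|u0] := pselect (u = 0); first by left.
move=> uv0; right; apply: fpsP => i.
apply: contrapT => /eqP /fps_lowest[e [c [w [_ c0 vE]]]].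
apply: u0; apply: fpsP => j.
apply: contrapT => /eqP /fps_lowest[e' [c' [w' [_ c'0 uE]]]].
(* In degree e' + e only the product of the two lowest coefficients survives. *)
have := congr1 (fun z => fcoef z (e' + e)) uv0.
rewrite uE vE mulrACA -exprD fcoefXnM ltnn subnn fcoef0M !fcoefD !fcoefXM !addr0 /=.
by move/eqP; rewrite mulf_eq0 (negPf c0) (negPf c'0).
Qed.

(** * The subring F[[y]] of S and expansion in powers of x *)

Section YSeries.
Variable F : fieldType.
Local Notation S := (Sring F).
Local Notation x := (xS F).
Local Notation y := (yS F).
Local Notation Y := (fpsX F).

Definition map_fpsC (v : fps F) : fps2 F := Fps (fun j => fpsC (fcoef v j)).

Lemma map_fpsC_is_additive : zmod_morphism map_fpsC.
Proof. by move=> u v; apply: fpsP => j; rewrite /= -rmorphB. Qed.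
Lemma map_fpsC_is_multiplicative : monoid_morphism map_fpsC.
Proof.
split=> [|u v]; apply: fpsP => j /=; last first.
  by rewrite rmorph_sum; apply: eq_bigr => i _; rewrite rmorphM.
by case: j => [|j] /=; rewrite ?rmorph1 ?rmorph0.
Qed.
HB.instance Definition _ :=
  GRing.isZmodMorphism.Build (fps F) (fps2 F) map_fpsC map_fpsC_is_additive.
HB.instance Definition _ :=
  GRing.isMonoidMorphism.Build (fps F) (fps2 F) map_fpsC map_fpsC_is_multiplicative.

Definition Spi : {rmorphism fps2 F -> S} := \pi_{ideal_quot (@Dinf_ideal F)}%qT.

(** The ring map from V to S sending the variable to y; it makes every S-module a V-module. *)
Definition yser (v : fps F) : S := Spi (map_fpsC v).

Lemma yser_is_additive : zmod_morphism yser.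
Proof. by move=> u v; rewrite /yser !rmorphB. Qed.
Lemma yser_is_multiplicative : monoid_morphism yser.
Proof. by split=> [|u v]; rewrite /yser ?rmorph1 ?rmorphM. Qed.
HB.instance Definition _ := GRing.isZmodMorphism.Build (fps F) S yser yser_is_additive.
HB.instance Definition _ :=
  GRing.isMonoidMorphism.Build (fps F) S yser yser_is_multiplicative.

Lemma yserD u v : yser (u + v) = yser u + yser v. Proof. exact: rmorphD. Qed.
Lemma yserB u v : yser (u - v) = yser u - yser v. Proof. exact: rmorphB. Qed.
Lemma yserM u v : yser (u * v) = yser u * yser v. Proof. exact: rmorphM. Qed.
Lemma yser0 : yser 0 = 0. Proof. exact: rmorph0. Qed.
Lemma yser1 : yser 1 = 1. Proof. exact: rmorph1. Qed.

Lemma yserX : yser Y = y.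
Proof.
congr (Spi _).
by apply: fpsP => -[|[|j]] /=; rewrite ?rmorph1 ?rmorph0.
Qed.

Lemma yserXn n : yser (Y ^+ n) = y ^+ n.
Proof. by rewrite -yserX; exact: rmorphXn. Qed.

Lemma fcoef2D (u v : fps2 F) j : fcoef (u + v) j = fcoef u j + fcoef v j.
Proof. by []. Qed.

(** Both F[[x]] and F[[y]] are [fps F]; here [Y] is the variable of the coefficient ring, so it
    stands for x. *)
Lemma fcoefX2M (v : fps2 F) j : fcoef (X2 F * v) j = Y * fcoef v j.
Proof. exact: fcoefCM. Qed.

Lemma fps2_decomp (s : fps2 F) : exists f0 f1 s',
  s = map_fpsC f0 + X2 F * map_fpsC f1 + X2 F ^+ 2 * s'.
Proof.
exists (Fps (fun j => fcoef (fcoef s j) 0)), (Fps (fun j => fcoef (fcoef s j) 1)).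
exists (Fps (fun j => Fps (fun i => fcoef (fcoef s j) i.+2))).
apply: fpsP => j; apply: fpsP => i.
rewrite expr2 -mulrA !fcoef2D !fcoefX2M !fcoefD.
by case: i => [|[|i]]; rewrite ?fcoefXM ?addr0 ?add0r.
Qed.

(** Sort by powers of x. Where x^2 acts as 0 only f0 and f1 matter, so S-linearity reduces to the
    actions of V and x. *)
Lemma Sring_decomp (s : S) : exists f0 f1 s',
  s = yser f0 + x * yser f1 + x ^+ 2 * s'.
Proof.
have [f0 [f1 [s' sE]]] := fps2_decomp (repr s).
exists f0, f1, (Spi s').
rewrite -[LHS]reprK -[\pi_(_)%qT _]/(Spi _) sE !rmorphD !rmorphM.
by [].
Qed.

Lemma fps2_pi_eq0 (f : fps2 F) : Spi f = 0 ->
  exists g, f = X2 F ^+ 2 * Y2 F * g.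
Proof.
move/eqP; rewrite -(rmorph0 Spi).
by rewrite -Quotient.idealrBE subr0 => /asboolP.
Qed.

Lemma map_fpsC_X2_eq0 (a b : fps F) (g : fps2 F) :
  map_fpsC a + X2 F * map_fpsC b = X2 F ^+ 2 * g -> a = 0 /\ b = 0.
Proof.
move=> abE; split; apply: fpsP => j.
  have := congr1 (fun w => fcoef (fcoef w j) 0) abE.
  by rewrite expr2 -mulrA !fcoef2D !fcoefX2M !fcoefD !fcoefXM addr0.
have := congr1 (fun w => fcoef (fcoef w j) 1) abE.
by rewrite expr2 -mulrA !fcoef2D !fcoefX2M !fcoefD !fcoefXM add0r.
Qed.

End YSeries.

(** * Homomorphisms, pp-formulae and direct summands *)

Section Retract.
Variable R : comNzRingType.

Lemma pp_sat_linear (M N : lmodType R) (f : {linear M -> N}) (theta : pp R) (v : M) :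
  pp_sat theta v -> pp_sat theta (f v).
Proof.
case=> w wE; exists (f \o w) => j; rewrite -linearZ /= -wE linear_sum.
by apply: eq_bigr => i _; rewrite linearZ.
Qed.

Section Kernel.
Variables (M N : lmodType R) (h : {linear M -> N}).

Definition linear_kernel : {pred M} := fun u => `[< h u = 0 >].

Lemma linear_kernel_closed : submod_closed linear_kernel.
Proof.
split; first by apply/asboolP; rewrite linear0.
by move=> a u v /asboolP hu /asboolP hv; apply/asboolP; rewrite linearP hu hv scaler0 addr0.
Qed.

HB.instance Definition _ :=
  GRing.isSubmodClosed.Build R M linear_kernel
    (GRing.submod_closed_semi linear_kernel_closed).

Record kernel_mod := KernelMod {
  kernel_val : M;
  kernel_valP : kernel_val \in linear_kernel }.

HB.instance Definition _ := [isSub for kernel_val].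
HB.instance Definition _ := [Choice of kernel_mod by <:].
HB.instance Definition _ := [SubChoice_isSubLmodule of kernel_mod by <:].

End Kernel.

(** Q is the direct sum of P and the kernel of h. As P contains the nonzero u, the kernel
    vanishes. *)
Lemma indecomposable_retract (P Q : lmodType R) (f : {linear P -> Q})
    (h : {linear Q -> P}) (u : P) :
  (forall p, h (f p) = p) -> u != 0 -> indecomposable Q -> module_iso Q P.
Proof.
move=> hf u0 [_ dec].
have kerP v : v - f (h v) \in linear_kernel h.
  by apply/asboolP; rewrite linearB hf subrr.
pose K : lmodType R := kernel_mod h.
pose g v : (P * K)%type := (h v, KernelMod (kerP v) : K).
have glin : linear g.
  move=> a v w; congr (_, _); first by rewrite linearP.
  by apply: val_inj; rewrite /= [h _]linearP [f _]linearP /= scalerBr opprD addrACA.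
pose gL := GRing.isLinear.Build R Q (P * K)%type *:%R g glin.
have iso : module_iso Q (P * K)%type.
  exists (HB.pack g gL : {linear Q -> (P * K)%type}) => /=.
  exists (fun w : (P * K)%type => f w.1 + val w.2) => [v|[p [v vP]]] /=.
    by rewrite addrC subrK.
  have hv : h v = 0 by apply/asboolP.
  congr (_, _); first by rewrite linearD hf hv addr0.
  by apply: val_inj; rewrite /= linearD hf hv addr0 addrC addKr.
case: (dec _ _ iso) => [P0|K0]; first by rewrite (P0 u) eqxx in u0.
exists h; exists f => // v.
have := congr1 val (K0 (KernelMod (kerP v))).
by move/subr0_eq.
Qed.

End Retract.

(** * Images of the generators m, n and F-linear functionals *)

Section Dinf.
Variable F : fieldType.
Local Notation S := (Sring F).
Local Notation x := (xS F).
Local Notation y := (yS F).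
Local Notation Y := (fpsX F).

Lemma scalerC (Q : lmodType S) (a b : S) (u : Q) : a *: (b *: u) = b *: (a *: u).
Proof. by rewrite !scalerA mulrC. Qed.

Definition Mk_related k (Q : lmodType S) (q r : Q) : Prop :=
  x *: q = y ^+ k *: r /\ x *: r = 0.

(** Since x^2 kills q and r, s acts through f0 and f1 alone. The formula is the same for all related
    pairs, so maps defined by coordinates are S-linear. *)
Lemma scale_related k (Q : lmodType S) (q r : Q) (f0 f1 a b : fps F) (s' : S) :
  Mk_related k q r ->
  (yser f0 + x * yser f1 + x ^+ 2 * s') *: (yser a *: q + yser b *: r) =
  yser (f0 * a) *: q + yser (f0 * b + Y ^+ k * f1 * a) *: r.
Proof.
case=> xq xr.
have xE c d : x *: (yser c *: q + yser d *: r) = (yser c * y ^+ k) *: r.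
  rewrite scalerDr !(scalerA x) ![x * _]mulrC -!scalerA xq xr scaler0 addr0.
  by rewrite scalerA.
have x2E : x ^+ 2 *: (yser a *: q + yser b *: r) = 0.
  by rewrite expr2 -scalerA xE scalerA mulrC -scalerA xr scaler0.
rewrite !scalerDl ![_ * s']mulrC -(scalerA s') x2E scaler0 addr0.
rewrite [x * _]mulrC -(scalerA _ x) xE scalerDr !scalerA -addrA -scalerDl.
by rewrite !yserD !yserM yserXn [in RHS](mulrC (y ^+ k)) -mulrA [y ^+ k * _]mulrC.
Qed.

Definition Flinear (N : lmodType S) (b : N -> F) : Prop :=
  forall c u v, b (yser (fpsC c) *: u + v) = c * b u + b v.

Lemma FlinearD (N : lmodType S) (b : N -> F) u v : Flinear b -> b (u + v) = b u + b v.
Proof. by move=> /(_ 1 u v); rewrite (rmorph1 (@fpsC F)) yser1 scale1r mul1r. Qed.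

Lemma Flinear0 (N : lmodType S) (b : N -> F) : Flinear b -> b 0 = 0.
Proof. by move=> /(_ (-1) 0 0); rewrite scaler0 add0r mulN1r addNr. Qed.

(** * V-linear maps assembled from coefficient functionals *)

Section Coefficients.
Variables (N : lmodType S) (beta : nat -> N -> F).
Hypothesis beta_lin : forall j, Flinear (beta j).
Hypothesis betaY : forall j u, beta j.+1 (y *: u) = beta j u.
Hypothesis betaY0 : forall u, beta 0 (y *: u) = 0.

Lemma coefficientsD u v : Fps (beta^~ (u + v)) = Fps (beta^~ u) + Fps (beta^~ v).
Proof. by apply: fpsP => j; rewrite /= FlinearD. Qed.

(** The coefficient of index j sees only finitely many coefficients of v, so splitting v as v(0) + y
    v' and inducting on j needs no continuity. *)
Lemma coefficients_yser v u : Fps (beta^~ (yser v *: u)) = v * Fps (beta^~ u).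
Proof.
apply: fpsP => j /=; elim: j v => [|j IHj] v; rewrite [in LHS](fps_split v).
  rewrite big_ord1 yserD yserM yserX scalerDl beta_lin -scalerA betaY0 addr0.
  by [].
rewrite yserD yserM yserX scalerDl beta_lin -scalerA betaY IHj [RHS]big_ord_recl.
by congr (_ + _); apply: eq_bigr => i _; rewrite /= /bump add1n subSS.
Qed.

End Coefficients.

(** * Maps out of and into a copy of M_k *)

Section Basis.
Variables (k : nat) (P : lmodType S) (m n : P).

(** [P] is a copy of M_k, with B as the case k = 0. *)
Definition Mk_basis : Prop :=
  [/\ Mk_related k m n,
      forall p : P, exists a b, p = yser a *: m + yser b *: n &
      forall a b, yser a *: m + yser b *: n = 0 -> a = 0 /\ b = 0].

Hypothesis basis : Mk_basis.

Lemma Mk_basis_inj a b a' b' :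
  yser a *: m + yser b *: n = yser a' *: m + yser b' *: n -> a = a' /\ b = b'.
Proof.
case: basis => _ _ free /eqP; rewrite -subr_eq0 opprD addrACA -!scalerBl -!yserB.
by move/eqP/free => [/subr0_eq-> /subr0_eq->].
Qed.

Lemma Mk_basis_CM : is_CM P.
Proof.
case: basis => rel span free p xp yp; have [a [b pE]] := span p.
suff [a0 b0] : a = 0 /\ b = 0 by rewrite pE a0 b0 !yser0 !scale0r addr0.
move: yp; rewrite pE scalerDr !scalerA -yserX -!yserM => /free[Ya Yb].
by split; apply: fpsX_inj; rewrite mulr0.
Qed.

Lemma Mk_basis_lift (Q : lmodType S) (q r : Q) : Mk_related k q r ->
  exists f : {linear P -> Q}, f m = q /\ f n = r.
Proof.
case: basis => rel span _ relQ.
have [ca /choice[cb cE]] := choice span.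
pose f p := yser (ca p) *: q + yser (cb p) *: r.
have fE a b : f (yser a *: m + yser b *: n) = yser a *: q + yser b *: r.
  by rewrite /f; have [<- <-] := Mk_basis_inj (cE (yser a *: m + yser b *: n)).
have flin : linear f.
  move=> s u v; have [f0 [f1 [s' ->]]] := Sring_decomp s.
  rewrite {1}(cE u) {1}(cE v) (scale_related _ _ _ _ _ rel) addrACA -!scalerDl -!yserD.
  by rewrite fE /f (scale_related _ _ _ _ _ relQ) addrACA -!scalerDl -!yserD.
pose fL := GRing.isLinear.Build S P Q *:%R f flin.
pose f' : {linear P -> Q} := HB.pack f fL.
exists f'; split; rewrite /f' /=.
  by have := fE 1 0; rewrite !(yser1, yser0, scale1r, scale0r, addr0).
by have := fE 0 1; rewrite !(yser1, yser0, scale1r, scale0r, add0r).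
Qed.

(** The n-coordinate B determines the m-coordinate A, because x m = y^k n forces y^k A(u) = B(x u).
    The hypotheses on x and x^2 make this division possible and compatible with x. *)
Lemma Mk_basis_colift (N : lmodType S) (beta : nat -> N -> F) :
    (forall j, Flinear (beta j)) ->
    (forall j u, beta j.+1 (y *: u) = beta j u) ->
    (forall u, beta 0 (y *: u) = 0) ->
    (forall j u, (j < k)%N -> beta j (x *: u) = 0) ->
    (forall j u, beta j (x ^+ 2 *: u) = 0) ->
  exists h : {linear N -> P}, forall u,
    h u = yser (Fps (fun j => beta (j + k)%N (x *: u))) *: m +
          yser (Fps (beta^~ u)) *: n.
Proof.
move=> blin bY bY0 bx bx2; case: basis => rel _ _.
pose B u := Fps (beta^~ u); pose A u := Fps (fun j => beta (j + k)%N (x *: u)).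
have BD u v : B (u + v) = B u + B v by exact: coefficientsD.
have BZ v u : B (yser v *: u) = v * B u by exact: coefficients_yser.
have Bx2 u : B (x ^+ 2 *: u) = 0 by apply: fpsP => j; rewrite /= bx2.
have Bx u : B (x *: u) = Y ^+ k * A u.
  apply: fpsP => j; rewrite fcoefXnM /=; case: ltnP => [/bx//|le_kj].
  by rewrite subnK.
pose h u := yser (A u) *: m + yser (B u) *: n.
have hlin : linear h.
  move=> s u v; have [f0 [f1 [s' ->]]] := Sring_decomp s.
  rewrite /h (scale_related _ _ _ _ _ rel) addrACA -!scalerDl -!yserD.
  have -> : (yser f0 + x * yser f1 + x ^+ 2 * s') *: u =
      yser f0 *: u + yser f1 *: (x *: u) + x ^+ 2 *: (s' *: u).
    by rewrite !scalerDl [x * _]mulrC -!scalerA.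
  congr (yser _ *: _ + yser _ *: _); last first.
    by rewrite !BD !BZ Bx2 addr0 Bx mulrA [f1 * _]mulrC.
  (* The m-coordinates are compared after multiplication by y^k, which turns A(u) into B(x u). *)
  apply: (@fpsXn_inj _ k); rewrite mulrDr mulrCA -!Bx -BZ.
  rewrite !scalerDr !BD !(scalerC x) !BZ [x *: (x *: u)]scalerA -expr2 !Bx2.
  by rewrite mulr0 !addr0.
pose hL := GRing.isLinear.Build S N P *:%R h hlin.
by exists (HB.pack h hL : {linear N -> P}).
Qed.

End Basis.

(** * The values forced on an extended functional *)

Section Partial.
Variables (k : nat) (N1 N2 : lmodType S) (f : {linear N1 -> N2}).
Variable beta : nat -> N1 -> F.
Hypothesis beta_lin : forall j, Flinear (beta j).
Hypothesis betaY : forall j u, beta j.+1 (y *: u) = beta j u.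
Implicit Types e : nat -> N2.

(** The sum of the [e i] y^(-i-1), up to the factor y^(l+1): finitely supported
    sequences represent elements of the localization of [N2] at y, modulo [N2]. *)
Definition twisted_sum l e : N2 := \sum_(i < l.+1) y ^+ (l - i) *: e i.

(** After division by y^(l+1), e equals y^(-l-1) f d plus p, y^(-k) x s and y^(-l-1) x^2 t. The
    functional sought must vanish on the last three and take the value of [beta l] at d on the
    first. The bound on k keeps the subtraction [l.+1 - k] exact. *)
Definition partial_functional l e (r : F) : Prop :=
  [/\ (k <= l.+1)%N, forall i, (l < i)%N -> e i = 0 &
   exists d p s t, twisted_sum l e =
     f d + (y ^+ l.+1 *: p + y ^+ (l.+1 - k) *: (x *: s) + x ^+ 2 *: t)
     /\ r = beta l d].

Lemma twisted_sumZD l a e e' :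
  twisted_sum l (a *: e + e') = a *: twisted_sum l e + twisted_sum l e'.
Proof.
rewrite scaler_sumr -big_split; apply: eq_bigr => i _.
by rewrite /= -scalerC -scalerDr.
Qed.

Lemma twisted_sumS l e : (forall i, (l < i)%N -> e i = 0) ->
  twisted_sum l.+1 e = y *: twisted_sum l e.
Proof.
move=> e0; rewrite /twisted_sum big_ord_recr /= e0 // scaler0 addr0 scaler_sumr.
by apply: eq_bigr => i _; rewrite scalerA -exprS subSn // -ltnS.
Qed.

Lemma twisted_sum_delta l j u : (j <= l)%N ->
  twisted_sum l (fun i => if i == j then u else 0) = y ^+ (l - j) *: u.
Proof.
move=> le_jl; rewrite /twisted_sum (bigD1 (Ordinal (le_jl : (j < l.+1)%N))) //= eqxx.
by rewrite big1 ?addr0 // => i ij; rewrite ifN ?scaler0.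
Qed.

(** Multiply the equation by y: d becomes y d, with the same value by [betaY], and the x^2 term dies
    because x^2 y = 0. Levels can thus be equalized before adding. *)
Lemma partial_functionalS l e r :
  partial_functional l e r -> partial_functional l.+1 e r.
Proof.
move=> [le_kl e0 [d [p [s [t [eE rE]]]]]]; split=> [|i /ltnW/e0//|]; first exact: leqW.
exists (y *: d), p, s, 0; rewrite twisted_sumS // eE betaY; split=> //.
rewrite [f (_ *: _)]linearZ /= !scalerDr scaler0 addr0 !(scalerA y) -!exprS -subSn //.
have -> : y * x ^+ 2 = 0 by rewrite mulrC Dinf_relation.
by rewrite scale0r addr0.
Qed.

Lemma partial_functional_le l l' e r : (l <= l')%N ->
  partial_functional l e r -> partial_functional l' e r.
Proof.
move=> /subnK <-; elim: (l' - l)%N => // i IHi /IHi.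
exact: partial_functionalS.
Qed.

Lemma partial_functionalZD l l' c e e' r r' :
    partial_functional l e r -> partial_functional l' e' r' ->
  partial_functional (maxn l l') (yser (fpsC c) *: e + e') (c * r + r').
Proof.
move=> /(partial_functional_le (leq_maxl l l')) + /(partial_functional_le (leq_maxr l l')).
move: (maxn l l') => {l l'}l [le_kl e0 [d [p [s [t [eE ->]]]]]].
move=> [_ e'0 [d' [p' [s' [t' [e'E ->]]]]]].
split=> // [i lt_li|].
  by rewrite -[LHS]/(_ *: e i + e' i) e0 // e'0 // scaler0 addr0.
pose a := yser (fpsC c).
exists (a *: d + d'), (a *: p + p'), (a *: s + s'), (a *: t + t').
split; last by rewrite beta_lin.
rewrite twisted_sumZD eE e'E [f (_ + _)]linearP !scalerDr !(scalerC a) addrACA.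
by congr (_ + _); rewrite [LHS]addrACA; congr (_ + _); rewrite addrACA.
Qed.

Lemma beta_yXn i l u : beta (i + l) (y ^+ i *: u) = beta l u.
Proof. by elim: i => [|i IHi]; rewrite ?scale1r // exprS -scalerA betaY. Qed.

End Partial.

(** * Extension of maps into a copy of M_k *)

Section Hom.
Variables (k : nat) (P : lmodType S) (m n : P).
Hypothesis basis : Mk_basis k m n.

(** The hypothesis says that the forced values are consistent at 0. They then extend to one
    functional on sequences, whose restrictions to the single entries are the coefficient
    functionals of h. *)
Lemma Mk_basis_extend (N1 N2 : lmodType S) (f : {linear N1 -> N2})
    (g : {linear N1 -> P}) :
    (forall l d p s t a b, (k <= l.+1)%N ->
       f d = y ^+ l.+1 *: p + y ^+ (l.+1 - k) *: (x *: s) + x ^+ 2 *: t ->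
       g d = yser a *: m + yser b *: n -> fcoef b l = 0) ->
  exists h : {linear N2 -> P}, forall u, h (f u) = g u.
Proof.
move=> f_obstruction; case: (basis) => rel span _.
have [ca /choice[cb cE]] := choice (fun d => span (g d)).
have coordZ v d : ca (yser v *: d) = v * ca d /\ cb (yser v *: d) = v * cb d.
  apply: (Mk_basis_inj basis); rewrite -cE linearZ /= cE scalerDr !scalerA.
  by rewrite -!yserM.
have coordD d d' : ca (d + d') = ca d + ca d' /\ cb (d + d') = cb d + cb d'.
  apply: (Mk_basis_inj basis); rewrite -cE linearD /= !cE addrACA.
  by rewrite -!scalerDl -!yserD.
have cbx d : cb (x *: d) = Y ^+ k * ca d.
  suff [] : ca (x *: d) = 0 /\ cb (x *: d) = Y ^+ k * ca d by [].
  apply: (Mk_basis_inj basis); rewrite -cE linearZ /= cE scalerDr !(scalerC x).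
  by case: rel => -> ->; rewrite yser0 scale0r scaler0 addr0 add0r scalerA yserM yserXn mulrC.
pose beta j d := fcoef (cb d) j.
have bE v d : cb (yser v *: d) = v * cb d by have [] := coordZ v d.
have blin j : Flinear (beta j).
  by move=> c u v; rewrite /beta (coordD _ _).2 bE fcoefD fcoefCM.
have bY j u : beta j.+1 (y *: u) = beta j u.
  by rewrite /beta -yserX bE fcoefXM.
pose G e r := exists l, partial_functional k f beta l e r.
have [|||H [Hlin HG]] := @linear_extension F S (@yser F \o @fpsC F) (nat -> N2) G.
- move=> c e r e' r' [l Ge] [l' Ge']; exists (maxn l l').
  exact: partial_functionalZD.
- exists k; split=> //; exists 0, 0, 0, 0.
  rewrite !linear0 ?scaler0 !addr0; split; last by rewrite Flinear0.
  by rewrite /twisted_sum big1 // => i _; exact: scaler0.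
(* For e = 0 the equation puts f d in the obstruction subgroup, up to signs. *)
- move=> r [l [le_kl _ [d [p [s [t [eE ->]]]]]]].
  apply: (f_obstruction l d (- p) (- s) (- t) _ _ le_kl _ (cE d)).
  rewrite !scalerN -!opprD; apply/eqP; rewrite -addr_eq0 -eE.
  by rewrite /twisted_sum big1 // => i _; exact: scaler0.
pose delta (j : nat) (u : N2) : nat -> N2 := fun i => if i == j then u else 0.
have deltaZD j a u v : delta j (a *: u + v) = a *: delta j u + delta j v.
  apply/funext => i; rewrite -[RHS]/(_ *: delta j u i + delta j v i) /delta.
  by case: eqP => _; rewrite ?scaler0 ?addr0.
pose beta' (j : nat) u := H (delta j u).
have b'lin j : Flinear (beta' j) by move=> c u v; rewrite /beta' deltaZD Hlin.
(* The forced value at a sequence concentrated at j may be computed at any level l with j <= l and k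
   <= l + 1. *)
have Gdelta l j u d p s t : (j <= l)%N -> (k <= l.+1)%N ->
    y ^+ (l - j) *: u = f d + (y ^+ l.+1 *: p + y ^+ (l.+1 - k) *: (x *: s) + x ^+ 2 *: t) ->
    beta' j u = beta l d.
  move=> le_jl le_kl uE; apply: HG; exists l; split=> // [i lt_li|].
    by rewrite /delta gtn_eqF // (leq_ltn_trans le_jl).
  by exists d, p, s, t; rewrite twisted_sum_delta.
have beta0 l : beta l 0 = 0 by rewrite Flinear0.
have [||||h hE] := Mk_basis_colift basis b'lin.
(* The difference of the two one-term sequences has twisted sum 0. *)
- move=> j u; apply/eqP; rewrite -subr_eq0 -mulN1r addrC -Hlin; apply/eqP.
  apply: HG; exists (j.+1 + k)%N; split=> [|i lt_li|].
  + by rewrite leqW // leq_addl.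
  + rewrite -[LHS]/(_ *: delta j u i + delta j.+1 (y *: u) i) /delta.
    have lt_ji : (j.+1 < i)%N by apply: leq_ltn_trans lt_li; rewrite leq_addr.
    by rewrite !gtn_eqF // ?(ltnW lt_ji) // scaler0 addr0.
  exists 0, 0, 0, 0; rewrite beta0 linear0 ?scaler0 !addr0; split=> //.
  rewrite twisted_sumZD !twisted_sum_delta ?leq_addr // ?(leq_trans _ (leq_addr _ _)) //.
  rewrite rmorphN rmorph1 scaleN1r.
  rewrite addSn subSS subSn ?leq_addr // addKn exprSr -scalerA addNr.
  by [].
- move=> u; rewrite (Gdelta k 0 _ 0 u 0 0) //.
  by rewrite linear0 ?scaler0 !addr0 add0r subn0 scalerA -exprSr.
(* At level j + k the exponent [l.+1 - k] is j + 1, and y^k x u = y^(j+1) x (y^(k-1-j) u). *)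
- move=> j u lt_jk; rewrite (Gdelta (j + k)%N j _ 0 0 (y ^+ (k.-1 - j) *: u) 0) ?leq_addr //.
    by rewrite leqW // leq_addl.
  rewrite linear0 ?scaler0 !add0r addr0 addKn -addSn addnK (scalerC x) [RHS]scalerA -exprD.
  by congr (y ^+ _ *: _); case: k lt_jk => // k' lt_jk; rewrite addSn subnKC.
- move=> j u; rewrite (Gdelta (j + k)%N j _ 0 0 0 (y ^+ k *: u)) ?leq_addr //.
    by rewrite leqW // leq_addl.
  by rewrite linear0 ?scaler0 !add0r addKn scalerC.
exists h => u; rewrite hE cE.
(* The new functionals extend the old ones: y^k moves f v from level j to level k + j. *)
have b'f j v : beta' j (f v) = beta j v.
  rewrite (Gdelta (k + j)%N j _ (y ^+ k *: v) 0 0 0) ?leq_addl //.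
  - by rewrite beta_yXn.
  - by rewrite leqW // leq_addr.
  by rewrite !scaler0 !addr0 addnK linearZ.
congr (yser _ *: _ + yser _ *: _); apply: fpsP => j /=; last by rewrite b'f.
by rewrite -linearZ b'f /beta cbx fcoefXnM ltnNge leq_addl /= addnK.
Qed.

End Hom.

(** * Cancellation of y in CM modules *)

Lemma scale_x_related k (Q : lmodType S) (q r : Q) a b : Mk_related k q r ->
  x *: (yser a *: q + yser b *: r) = yser (Y ^+ k * a) *: r.
Proof.
case=> xq xr; rewrite scalerDr !(scalerC x) xq xr scaler0 addr0 scalerA.
by rewrite yserM yserXn mulrC.
Qed.

Lemma scale_xx_related k (Q : lmodType S) (q r : Q) a b : Mk_related k q r ->
  x ^+ 2 *: (yser a *: q + yser b *: r) = 0.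
Proof.
move=> rel; rewrite expr2 -scalerA (scale_x_related _ _ rel) scalerC.
by case: rel => _ ->; rewrite scaler0.
Qed.

(** If y u = 0 and x^2 u = 0, then x and y kill x u, so x u = 0, and hence u = 0. *)
Lemma CM_y_regular (Q : lmodType S) i (u : Q) :
  is_CM Q -> x ^+ 2 *: u = 0 -> y ^+ i *: u = 0 -> u = 0.
Proof.
move=> cmQ; elim: i u => [|i IHi] u xxu; first by rewrite scale1r.
rewrite exprSr -scalerA => /IHi yu.
have {}yu : y *: u = 0 by apply: yu; rewrite scalerC xxu scaler0.
apply: (cmQ _ _ yu); apply: cmQ; first by rewrite scalerA -expr2.
by rewrite scalerC yu scaler0.
Qed.

Lemma CM_y_cancel (Q : lmodType S) i (u v : Q) : is_CM Q ->
  x ^+ 2 *: u = 0 -> x ^+ 2 *: v = 0 -> y ^+ i *: u = y ^+ i *: v -> u = v.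
Proof.
move=> cmQ xxu xxv uv; apply: subr0_eq; apply: (@CM_y_regular Q i) => //.
  by rewrite scalerBr xxu xxv subr0.
by rewrite scalerBr uv subrr.
Qed.

(** The term y f r is absorbed into y^(k+1) Q, and c is inverted. *)
Lemma divides_lowest (Q : lmodType S) k (r t w : Q) c f : c != 0 ->
    y ^+ k *: (yser (fpsC c + Y * f) *: r) = y ^+ k.+1 *: t + (x * y) *: w ->
  exists t' w' : Q, y ^+ k *: r = y ^+ k.+1 *: t' + (x * y) *: w'.
Proof.
move=> c0 rE; pose d := yser (fpsC c^-1).
have dc : d * yser (fpsC c) = 1.
  by rewrite -yserM -(rmorphM (@fpsC F)) mulVf // (rmorph1 (@fpsC F)) yser1.
exists (d *: (t - yser f *: r)), (d *: w).
rewrite !(scalerC _ d) -scalerDr scalerBr addrAC -rE yserD yserM yserX scalerDl.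
by rewrite scalerDr exprSr -!scalerA addrK (scalerC d) (scalerA d) dc scale1r.
Qed.

(** * M_k as a point of the spectrum and as a direct summand *)

Section Basis.
Variables (k : nat) (P : lmodType S) (m n : P).
Hypothesis basis : Mk_basis k m n.

(** Purity moves the obstruction equation from N2 to N1. Applying g then shows that the n-coordinate
    of g d is divisible by y^(l+1), so its coefficient at l vanishes. *)
Lemma Mk_basis_pure_injective : pure_injective P.
Proof.
move=> N1 N2 f g pure; apply: (Mk_basis_extend basis) => l d p s t a b le_kl fd gd.
case: (basis) => rel span _.
pose A : 'M[S]_(3, 1) :=
  \matrix_(i, j) [:: y ^+ l.+1; y ^+ (l.+1 - k) * x; x ^+ 2]`_i.
have [|w wE] := pure 3 1%N A (fun=> d).
  exists (fun i => [:: p; s; t]`_i) => j.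
  by rewrite !big_ord_recl big_ord0 !mxE /= addr0 fd addrA scalerA.
have {wE} := wE ord0; rewrite !big_ord_recl big_ord0 !mxE /= addr0 => wE.
move: (w _) (w _) (w _) wE => t' s' p' dE.
have [a0 [b0 pE]] := span (g p'); have [a1 [b1 sE]] := span (g s').
have [a2 [b2 tE]] := span (g t').
have [_ ->] : a = Y ^+ l.+1 * a0 /\ b = Y ^+ l.+1 * (b0 + a1).
  apply: (Mk_basis_inj basis); rewrite -gd -dE !linearD !linearZ /= pE sE tE.
  rewrite (scale_xx_related _ _ rel) addr0 -scalerA (scale_x_related _ _ rel).
  rewrite scalerDr !scalerA -!yserXn -!yserM -addrA -scalerDl -yserD.
  by rewrite mulrDr [Y ^+ (_ - k) * _]mulrA -exprD subnK.
by rewrite fcoefXnM ltnSn.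
Qed.

Lemma Mk_basis_neq0 : m != 0.
Proof.
apply/eqP => m0; case: basis => _ _ /(_ 1 0).
rewrite m0 yser0 scale0r scaler0 addr0 => /(_ erefl)[/eqP].
by rewrite oner_eq0.
Qed.

(** The projection e onto N1 is an idempotent endomorphism. Commuting with x makes its matrix
    triangular with equal diagonal entries d, and d^2 = d in the domain V leaves e = 0 or e = 1. *)
Lemma Mk_basis_indecomposable : indecomposable P.
Proof.
split=> [|N1 N2 [f [g fK gK]]]; first by exists m; exact: Mk_basis_neq0.
have f_inj := can_inj fK.
case: (basis) => rel span _; case: (rel) => xm xn.
pose e p := g ((f p).1, 0).
have fe p : f (e p) = ((f p).1, 0) by rewrite gK.
have eD u v : e (u + v) = e u + e v.
  by apply: f_inj; rewrite linearD !fe linearD; congr (_, _); rewrite addr0.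
have eZ c u : e (c *: u) = c *: e u.
  by apply: f_inj; rewrite linearZ /= !fe linearZ; congr (_, _); rewrite scaler0.
have ee u : e (e u) = e u by rewrite /e gK.
have [a [b mE]] := span (e m); have [c [d nE]] := span (e n).
have Yinj u : Y ^+ k * u = 0 -> u = 0.
  by move=> Yu; apply: (@fpsXn_inj _ k); rewrite mulr0.
have n_inj u v : yser u *: n = yser v *: n -> u = v.
  rewrite -[LHS]add0r -[RHS]add0r -(scale0r m) -yser0.
  by case/(Mk_basis_inj basis).
have c0 : c = 0.
  have := congr1 e xn; rewrite eZ nE (scale_x_related _ _ rel) -(scale0r n) eZ scale0r.
  by rewrite -(scale0r n) -yser0 => /n_inj/Yinj.
move: nE; rewrite {c}c0 yser0 scale0r add0r => nE.
have ad : a = d.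
  have := congr1 e xm; rewrite !eZ mE nE (scale_x_related _ _ rel) scalerA.
  by rewrite -yserXn -yserM => /n_inj/fpsXn_inj.
move: mE; rewrite {a}ad => mE.
have dd : d * (d - 1) = 0.
  have := ee n; rewrite nE eZ nE scalerA -yserM => /n_inj dd;
    by rewrite mulrBr dd mulr1 subrr.
have emm := ee m; rewrite mE eD !eZ mE nE in emm.
have [d0|/subr0_eq d1] := fps_mulf_eq0 dd.
  left=> u; have e0 p : e p = 0.
    have [a1 [b1 ->]] := span p; rewrite eD !eZ.
    move: emm; rewrite nE mE d0 yser0 !scale0r scaler0 !add0r => <-.
    by rewrite !scaler0 addr0.
  have := fe (g (u, 0)); rewrite e0 linear0 gK.
  by case.
right=> u; have eid p : e p = p.
  have b0 : b = 0.
    move: emm; rewrite d1 yser1 !scale1r -addrA -scalerDl -yserD -[m]scale1r -yser1.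
    by case/(Mk_basis_inj basis) => _ /eqP; rewrite -subr_eq0 addrK => /eqP.
  have [a1 [b1 ->]] := span p; rewrite eD !eZ nE mE d1 b0.
  by rewrite yser1 yser0 scale0r !scale1r addr0.
by have := fe (g (0, u)); rewrite eid gK; case.
Qed.

Lemma Mk_basis_ZCM_point : ZCM_point P.
Proof.
split; [exact: Mk_basis_indecomposable|exact: Mk_basis_pure_injective|].
exact: Mk_basis_CM basis.
Qed.

(** The identity of P is extended along the map f sending m, n to q, r. A nonzero obstruction would
    put x q = y^k r in y^(k+1) Q + x y Q. *)
Lemma Mk_basis_retract (Q : lmodType S) (q r : Q) : is_CM Q ->
    Mk_related k q r -> (forall t w : Q, x *: q <> y ^+ k.+1 *: t + (x * y) *: w) ->
  exists (f : {linear P -> Q}) (h : {linear Q -> P}),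
    f m = q /\ forall p, h (f p) = p.
Proof.
move=> cmQ rel qr; have [f [fm fn]] := Mk_basis_lift basis rel.
have [xq xr] := rel.
have no_lowest c w t u : c != 0 ->
    y ^+ k *: (yser (fpsC c + Y * w) *: r) <> y ^+ k.+1 *: t + (x * y) *: u.
  by move=> c0 /(divides_lowest c0)[t' [u']]; rewrite -xq; exact: qr.
have xxr : x ^+ 2 *: r = 0 by rewrite expr2 -scalerA xr scaler0.
have xxy (z : Q) : x ^+ 2 *: (y *: z) = 0 by rewrite scalerA Dinf_relation scale0r.
have xxyS i (z : Q) : x ^+ 2 *: (y ^+ i.+1 *: z) = 0.
  by rewrite (exprS y) -(scalerA y) xxy.
have xxyx (z : Q) : y *: (x *: (x *: z)) = 0 by rewrite (scalerA x) -expr2 scalerC xxy.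
exists f; suff [h hf] : exists h : {linear Q -> P}, forall p, h (f p) = idfun p.
  by exists h.
apply: (Mk_basis_extend basis) => l d p s t a b le_kl fd /= dE.
have {fd dE} rE : yser a *: q + yser b *: r =
    y ^+ l.+1 *: p + y ^+ (l.+1 - k) *: (x *: s) + x ^+ 2 *: t.
  by rewrite -fd dE linearD !linearZ /= fm fn.
have yeE e (z : Q) : (e <= l)%N -> y ^+ e.+1 *: (y ^+ (l - e) *: z) = y ^+ l.+1 *: z.
  by move=> le_el; rewrite scalerA -exprD addSn subnKC.
have yeU e (u : fps F) i : (e <= l)%N ->
    y ^+ e.+1 *: (y ^+ i *: (yser u *: r)) = y ^+ i.+1 *: (yser (Y ^+ e * u) *: r).
  by rewrite yserM yserXn !scalerA !mulrA -!exprD !addSn addnC.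
(* Multiplying by x y kills the s and t terms and leaves y^(k+1) a r = y^(l+1) x y p. If a had a
   lowest exponent e <= l, cancelling y^(e+1) would contradict [no_lowest]. *)
have [a' aE] : exists a', a = Y ^+ l.+1 * a'.
  apply: fps_div_Xn => i lt_il; apply: contrapT => /eqP/fps_lowest.
  move=> [e [c [w [le_ei c0 aE]]]].
  have le_el : (e <= l)%N by rewrite (leq_trans le_ei).
  apply: (no_lowest c w 0 (y ^+ (l - e) *: p)) => //; rewrite scaler0 add0r.
  apply: (@CM_y_cancel Q e.+1) => //.
  - by rewrite !(scalerC (x ^+ 2)) xxr !scaler0.
  - by rewrite -scalerA scalerC xxy scaler0.
  rewrite yeU // -aE [RHS]scalerC yeE //.
  have := congr1 (fun z => y *: (x *: z)) rE; rewrite /= (scale_x_related _ _ rel).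
  rewrite mulrC yserM yserXn -scalerA !(scalerDr x) !(scalerDr y).
  rewrite [x *: (y ^+ _ *: (x *: s))]scalerC [y *: (y ^+ (_ - k) *: _)]scalerC xxyx.
  rewrite (expr2 x) -(scalerA x x t) xxyx scaler0 !addr0 => rE'.
  by rewrite (exprS y) -!scalerA [y ^+ k *: _]scalerC rE' scalerC.
(* Now a q is absorbed into y^(l+1) Q. Multiplying by y^(k+1) kills the t term, and cancelling
   y^(e+1) gives the contradiction again. *)
apply: contrapT => /eqP/fps_lowest[e [c [w [le_el c0 bE]]]].
apply: (no_lowest c w (y ^+ (l - e) *: (p - yser a' *: q)) (y ^+ (l - e) *: s)) => //.
apply: (@CM_y_cancel Q e.+1) => //.
- by rewrite !(scalerC (x ^+ 2)) xxr !scaler0.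
- by rewrite scalerDr xxyS -(scalerA x y) (scalerC (x ^+ 2) x) xxy scaler0 addr0.
rewrite yeU // -bE scalerDr [y ^+ e.+1 *: (y ^+ k.+1 *: _)]scalerC.
rewrite [y ^+ e.+1 *: ((x * y) *: _)]scalerC !yeE //.
have -> : yser b *: r = y ^+ l.+1 *: (p - yser a' *: q) + y ^+ (l.+1 - k) *: (x *: s) + x ^+ 2 *: t.
  apply: (addrI (yser a *: q)); rewrite rE aE yserM yserXn -scalerA.
  by rewrite scalerBr !addrA [_ *: (yser a' *: q) + _]addrC addrK.
rewrite !scalerDr [y ^+ k.+1 *: (x ^+ 2 *: t)]scalerC xxyS addr0.
congr (_ + _); rewrite !scalerA -exprD addSn subnKC //.
by rewrite -[x * y * _]mulrA -exprS [x * _]mulrC.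
Qed.

End Basis.

(** * The minimal pair *)

Definition upper_pp k : pp S :=
  Pp (\matrix_(i < 1, j < 2) [:: y ^+ k; x]`_j) (\row_(j < 2) [:: x; 0]`_j).

(** The unknowns are r, t, w; the columns are the equations y^k r = x v, x r = 0 and y^(k+1) t + x y
    w = x v. *)
Definition lower_pp k : pp S :=
  Pp (\matrix_(i < 3, j < 3)
        (nth [::] [:: [:: y ^+ k; x; 0]; [:: 0; 0; y ^+ k.+1]; [:: 0; 0; x * y]] i)`_j)
     (\row_(j < 3) [:: x; 0; x]`_j).

Lemma upper_ppP k (Q : lmodType S) (q : Q) :
  pp_sat (upper_pp k) q <-> exists r, Mk_related k q r.
Proof.
split=> [[w wE]|[r [xq xr]]].
  exists (w ord0); move: (wE ord0) (wE (lift ord0 ord0)).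
  by rewrite !big_ord1 !mxE /= scale0r => e1 e2; split.
exists (fun=> r) => -[[|[|//]] j2]; rewrite big_ord1 !mxE /= ?xq //.
by rewrite scale0r.
Qed.

Lemma lower_ppP k (Q : lmodType S) (q : Q) :
  pp_sat (lower_pp k) q <->
  (exists r, Mk_related k q r) /\
  exists t w, x *: q = y ^+ k.+1 *: t + (x * y) *: w.
Proof.
split=> [[w wE]|[[r [xq xr]] [t [w xq']]]].
  move: (wE ord0) (wE (lift ord0 ord0)) (wE ord_max).
  rewrite !big_ord_recl !big_ord0 !mxE /= !scale0r !addr0 !add0r.
  move=> e1 e2 e3; split; last by do 2!eexists; rewrite -e3.
  by eexists; split; [rewrite -e1|exact: e2].
exists (fun i => [:: r; t; w]`_i) => j.
rewrite !big_ord_recl big_ord0 !mxE /=.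
by case: j => -[|[|[|//]]] j3 /=; rewrite ?scale0r ?addr0 ?add0r.
Qed.

Lemma Mk_basis_isolated k (P : lmodType S) (m n : P) :
  Mk_basis k m n -> isolated_by_minimal_pair P.
Proof.
move=> basis; have [rel span _] := basis; have [xm xn] := rel.
have retract (Q : lmodType S) (q : Q) : is_CM Q ->
    pp_sat (upper_pp k) q -> ~ pp_sat (lower_pp k) q ->
    exists (f : {linear P -> Q}) (h : {linear Q -> P}), f m = q /\ forall p, h (f p) = p.
  move=> cmQ /upper_ppP[r relQ] nlow; apply: (Mk_basis_retract basis cmQ relQ).
  by move=> t w qE; apply: nlow; apply/lower_ppP; split; [exists r|exists t, w].
have cmP := Mk_basis_CM basis.
have up_m : pp_sat (upper_pp k) m by apply/upper_ppP; exists n.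
(* In P the n-coordinates of y^(k+1) P + x y P are divisible by y^(k+1), whereas x m = y^k n. *)
have nlow_m : ~ pp_sat (lower_pp k) m.
  move/lower_ppP => [_ [t [w]]].
  have [a [b ->]] := span t; have [a' [b' ->]] := span w.
  rewrite (mulrC x) -scalerA (scale_x_related _ _ rel) xm scalerDr !scalerA.
  rewrite -!yserXn -yserX -!yserM -addrA -scalerDl -yserD -[LHS]add0r -(scale0r m) -yser0.
  case/(Mk_basis_inj basis) => _ /(congr1 (fun u => fcoef u k)).
  rewrite mulrA -exprS -mulrDr fcoefXnM ltnSn -[Y ^+ k]mulr1 fcoefXnM ltnn subnn /=.
  by move/eqP; rewrite oner_eq0.
exists (upper_pp k), (lower_pp k); split; split.
- by split=> [M _ v /lower_ppP[/upper_ppP]|/(_ P cmP m up_m)].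
- case=> theta [[low_theta ntheta_low] [theta_up nup_theta]].
  (* Each v satisfying the upper formula is an image of m, so m cannot satisfy theta. But a q
     satisfying theta and not the lower formula is sent to m by a retraction. *)
  apply: nup_theta => M cmM v /upper_ppP[r relM].
  have [f [<- _]] := Mk_basis_lift basis relM; apply: pp_sat_linear.
  apply: contrapT => ntheta_m; apply: ntheta_low => Q cmQ q theta_q.
  apply: contrapT => nlow_q.
  have [g [h [gm hg]]] := retract Q q cmQ (theta_up Q cmQ q theta_q) nlow_q.
  by apply: ntheta_m; rewrite -(hg m) gm; exact: pp_sat_linear.
- exact: Mk_basis_ZCM_point basis.
- by move/(_ m up_m).
move=> Q [indQ _ cmQ] /existsNP[q /not_implyP[up_q nlow_q]].
have [f [h [_ hf]]] := retract Q q cmQ up_q nlow_q.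
exact: indecomposable_retract hf (Mk_basis_neq0 basis) indQ.
Qed.

(** * Bases of M_k and B over V *)

Lemma related_span k (Q : lmodType S) (q r : Q) (s t : S) : Mk_related k q r ->
  exists a b, s *: q + t *: r = yser a *: q + yser b *: r.
Proof.
move=> rel; have [f0 [f1 [s' ->]]] := Sring_decomp s.
have [g0 [g1 [t' ->]]] := Sring_decomp t.
have := scale_related f0 f1 1 0 s' rel; have := scale_related g0 g1 0 1 t' rel.
rewrite !(mulr0, mulr1) !yser0 !yser1 !scale0r !scale1r !add0r !addr0 => -> ->.
by do 2!eexists; rewrite -addrA -scalerDl -yserD.
Qed.

(** The defining relation x^2 y is itself a multiple of x^2, so coefficients of 1 and x can be
    compared in F[[x,y]]. *)
Lemma yser_x_free a b (s : S) : yser a + x * yser b = x ^+ 2 * s -> a = 0 /\ b = 0.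
Proof.
rewrite -(reprK s) => abE.
have : Spi F (map_fpsC a + X2 F * map_fpsC b - X2 F ^+ 2 * repr s) = 0.
  by rewrite rmorphB rmorphD !rmorphM; apply/eqP; rewrite subr_eq0; apply/eqP.
case/fps2_pi_eq0 => g /eqP; rewrite subr_eq -mulrA -mulrDr => /eqP.
exact: map_fpsC_X2_eq0.
Qed.

Lemma Mk_has_basis k : Mk_basis k (Mk_m F k) (Mk_n F k).
Proof.
have rel : Mk_related k (Mk_m F k) (Mk_n F k).
  by split; [exact: Mk_relation1|exact: Mk_relation2].
split=> // [p|a b].
  rewrite -(coker_reprK p); move: (repr _) => u.
  have -> : coker_pi (Mk_rel F k) u = u 0 0 *: Mk_m F k + u 0 1 *: Mk_n F k.
    rewrite -[_ *: Mk_m F k]coker_piZ -[_ *: Mk_n F k]coker_piZ -coker_piD.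
    congr (coker_pi _ _); apply/rowP => j; rewrite !mxE.
    case: j => [[|[|//]] j2] /=; rewrite ?mulr1 ?mulr0 ?addr0 ?add0r;
      by apply: (congr1 (u 0)); apply: val_inj.
  exact: related_span rel.
rewrite -[_ *: Mk_m F k]coker_piZ -[_ *: Mk_n F k]coker_piZ -coker_piD.
have -> : (0 : Mk F k) = coker_pi (Mk_rel F k) 0 by rewrite /coker_pi raddf0.
case/coker_piP => c; rewrite subr0 => /rowP cE.
move: (cE 0) (cE 1); rewrite !mxE !big_ord_recl !big_ord0 !mxE /=.
rewrite ?mulr0 ?mulr1 ?addr0 ?add0r => aE bE.
have [f0 [f1 [s' cE0]]] := Sring_decomp (c 0 ord0).
have [g0 [g1 [t' cE1]]] := Sring_decomp (c 0 (lift ord0 ord0)).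
(* The row relations read a = x c_0 and b = - y^k c_0 + x c_1; they are compared modulo x^2. *)
have [a0 f00] : a = 0 /\ - f0 = 0.
  apply: (@yser_x_free _ _ (yser f1 + x * s')).
  rewrite aE cE0 -[- f0]sub0r yserB yser0.
  ring.
have [b0 _] : b = 0 /\ Y ^+ k * f1 - g0 = 0.
  apply: (@yser_x_free _ _ (yser g1 + x * t' - y ^+ k * s')).
  move/eqP: f00; rewrite oppr_eq0 => /eqP f00.
  rewrite bE cE0 cE1 f00 yserB yserM yserXn yser0.
  ring.
by [].
Qed.

Lemma Bmod_has_basis : exists m n : Bmod F, Mk_basis 0 m n.
Proof.
have yP : (y : S^o) \in principal y by apply/asboolP; exists 1; rewrite mulr1.
(* The basis of B is y, x y, and x (x y) = 0 is the relation of S. *)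
pose m : Bmod F := PrincipalMod yP; exists m, (x *: m).
have rel : Mk_related 0 m (x *: m).
  split; first by rewrite scale1r.
  by apply: val_inj; rewrite scalerA; exact: Dinf_relation.
split=> // [[p pP]|a b].
  have /asboolP[t pE] := pP.
  have -> : PrincipalMod pP = t *: m + 0 *: (x *: m).
    by rewrite scale0r addr0; apply: val_inj; rewrite /= pE; exact: mulrC.
  exact: related_span rel.
rewrite scalerA -scalerDl => /(congr1 val) /= abE.
have : Spi F (fpsX (fps F) * (map_fpsC a + X2 F * map_fpsC b)) = 0.
  rewrite rmorphM rmorphD rmorphM mulrC [X in _ + X]mulrC; exact: abE.
case/fps2_pi_eq0 => g; rewrite mulrAC [_ * Y2 F]mulrC => /fpsX_inj.
exact: map_fpsC_X2_eq0.
Qed.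

End Dinf.

Local Close Scope ring_scope.

Theorem lemma7p2 (F : closedFieldType) (charF : 2 \notin [pchar F]%R) :
  (forall k : nat, 1 <= k -> isolated_by_minimal_pair (Mk F k)) /\
  isolated_by_minimal_pair (Bmod F).
Proof.
split=> [k _|]; first exact: Mk_basis_isolated (Mk_has_basis F k).
by have [m [n basis]] := Bmod_has_basis F; exact: Mk_basis_isolated basis.
Qed.
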